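(* Let $k_1,\ldots,k_n\ge 1$ be integers, let $L=\prod_{i=1}^n\{0,\ldots,k_i-1\}$, and let $f:L\to\mathbb{R}$ be lattice submodular with $f(0)=0$. Then $f=g+h$ for some modular function $g:L\to\mathbb{R}$ and some monotone (nondecreasing) lattice submodular function $h:L\to\mathbb{R}$ with $h(0)=0$.
   Context: $L$ is ordered componentwise, and $\min(x,y)$, $\max(x,y)$ denote componentwise minimum and maximum. A function $f:L\to\mathbb{R}$ is lattice submodular if $f(x)+f(y)\ge f(\min(x,y))+f(\max(x,y))$ for all $x,y\in L$, and modular if equality holds for all $x,y\in L$. A function $h$ is monotone if $x\le y$ implies $h(x)\le h(y)$. *)

(* Defs.v *)
From mathcomp Require Import all_boot all_order all_algebra.
From mathcomp Require Import reals.

Set Implicit Arguments.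
Unset Strict Implicit.
Unset Printing Implicit Defensive.

Import Order.TTheory GRing.Theory Num.Theory.

Local Open Scope ring_scope.

(* The lattice L = prod_i {0, ..., k_i - 1}: a point x has coordinates
   x i : 'I_(k i). *)
Notation grid k := {dffun forall i, 'I_(k i)}.

Definition grid_le n (k : 'I_n -> nat) (x y : grid k) : Prop :=
  forall i, (x i <= y i)%N.

Definition grid_min n (k : 'I_n -> nat) (x y : grid k) : grid k :=
  [ffun i : 'I_n => Order.min (x i) (y i) : 'I_(k i)].

Definition grid_max n (k : 'I_n -> nat) (x y : grid k) : grid k :=
  [ffun i : 'I_n => Order.max (x i) (y i) : 'I_(k i)].

(* The proof that every k i is positive is what makes 0 a point of L. *)
Definition grid0 n (k : 'I_n -> nat) (hk : forall i, (1 <= k i)%N) : grid k :=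
  [ffun i : 'I_n => Ordinal (hk i)].

Definition lattice_submodular (R : realType) n (k : 'I_n -> nat)
    (f : grid k -> R) : Prop :=
  forall x y : grid k, f x + f y >= f (grid_min x y) + f (grid_max x y).

Definition modular (R : realType) n (k : 'I_n -> nat)
    (f : grid k -> R) : Prop :=
  forall x y : grid k, f x + f y = f (grid_min x y) + f (grid_max x y).

Definition monotone (R : realType) n (k : 'I_n -> nat)
    (h : grid k -> R) : Prop :=
  forall x y : grid k, grid_le x y -> h x <= h y.

(* Main.v *)
(* Since L is finite, |f x| + |f y| is bounded by a constant C.  Strictly
   increasing a point raises its coordinate sum by at least 1, so
   h x = f x + C * (sum of the x i) is monotone; the coordinate sum is modular,
   so h is still submodular. *)
Require Import Defs.
From mathcomp Require Import all_boot all_order all_algebra.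
From mathcomp Require Import reals.
From mathcomp Require Import lra.

Import Order.TTheory GRing.Theory Num.Theory.

Local Open Scope ring_scope.

Definition weight {n} {k : 'I_n -> nat} (x : grid k) : nat :=
  (\sum_(i < n) x i)%N.

(** In each coordinate, the minimum and the maximum are the two given values in some order. *)
Lemma weight_min_max {n} {k : 'I_n -> nat} (x y : grid k) :
  (weight (grid_min x y) + weight (grid_max x y) = weight x + weight y)%N.
Proof.
rewrite /weight -!big_split /=; apply: eq_bigr => i _.
by rewrite !ffunE; case: (leP (x i) (y i)) => _ //; rewrite addnC.
Qed.

Lemma weight_grid0 {n} {k : 'I_n -> nat} (hk : forall i, (1 <= k i)%N) :
  weight (grid0 hk) = 0%N.
Proof. by rewrite /weight big1 // => i _; rewrite ffunE. Qed.

(** Coordinatewise inequalities add up, and the two sums agree only when every coordinate does;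
    [leqif] carries this equality case along. *)
Lemma eq_or_weight_lt {n} {k : 'I_n -> nat} (x y : grid k) :
  grid_le x y -> x = y \/ (weight x < weight y)%N.
Proof.
move=> le_xy.
have lif : (weight x <= weight y ?= iff [forall i, x i == y i :> nat])%N.
  by apply: leqif_sum => i _; apply: leqif_eq.
have [/forallP eq_xy | ne_xy] := boolP [forall i, x i == y i :> nat].
  by left; apply/ffunP => i; apply/val_inj/eqP/eq_xy.
by right; rewrite ltn_neqAle !lif ne_xy.
Qed.

(** Each norm is one term of a sum of nonnegative terms. Bounding the two separately costs the
    factor 2 but also covers [x = y]. *)
Lemma add_norm_le_sum {R : realType} {T : finType} (f : T -> R) (x y : T) :
  `|f x| + `|f y| <= 2 * \sum_z `|f z|.
Proof.
have norm_le z : `|f z| <= \sum_t `|f t|.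
  by rewrite (bigD1 z) //= lerDl sumr_ge0.
by have := norm_le x; have := norm_le y; lra.
Qed.

Theorem theorem4p1 (R : realType) (n : nat) (k : 'I_n -> nat)
    (hk : forall i : 'I_n, (1 <= k i)%N) (f : grid k -> R)
    (hf : lattice_submodular f) (hf0 : f (grid0 hk) = 0) :
  exists g h : grid k -> R,
    [/\ modular g, monotone h, lattice_submodular h, h (grid0 hk) = 0
      & forall x : grid k, f x = g x + h x].
Proof.
pose C : R := 2 * \sum_(z : grid k) `|f z|.
exists (fun x => - (C * (weight x)%:R)), (fun x => f x + C * (weight x)%:R).
have w_mod (x y : grid k) :
    C * (weight (grid_min x y))%:R + C * (weight (grid_max x y))%:R
    = C * (weight x)%:R + C * (weight y)%:R.
  by rewrite -!mulrDr -!natrD weight_min_max.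
split.
- by move=> x y; have := w_mod x y; lra.
- move=> x y /eq_or_weight_lt[-> // | lt_w].
  have C_ge : `|f x| + `|f y| <= C := add_norm_le_sum f x y.
  have C_ge0 : 0 <= C by apply: le_trans C_ge; rewrite addr_ge0.
  (* Weights are integers, so the strict increase gains at least one full [C], which absorbs the
     possible drop [f x - f y <= |f x| + |f y| <= C]. *)
  have : C * (weight x).+1%:R <= C * (weight y)%:R.
    by rewrite ler_wpM2l // ler_nat.
  rewrite -natr1 mulrDr mulr1.
  by have := ler_norm (f x); have := ler_norm (- f y); rewrite normrN; lra.
- by move=> x y; have := hf x y; have := w_mod x y; lra.
- by rewrite hf0 weight_grid0 mulr0 addr0.
- by move=> x; rewrite addrC addrK.
Qed.
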